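(* Let $a_0(n)$, $a_1(n)$ be bounded convergent real sequences which satisfy, for all $n$, $2a_0(n)+a_1(n)=1$ and ($a_0(n)<0$ or $a_1(n)+a_0(n)<0$), and let $l_i=\lim_{n\to\infty}a_i(n)$, $i=0,1$. If $f\in C[0,1]$ and $f''$ exists at a certain point $x\in[0,1]$, then $$\lim_{n\to\infty} n\left[D_n^{M,1}(f;x)-f(x)\right]=(1-2x)(2l_1+3l_0)f'(x)+x(1-x)(2l_0+l_1)f''(x).$$ Moreover, this relation holds uniformly on $[0,1]$ if $f''\in C[0,1]$.
   Context: For integers $n\ge 0$ and $k$, $p_{n,k}(x)=\binom{n}{k}x^k(1-x)^{n-k}$ for $0\le k\le n$, and $p_{n,k}(x)=0$ if $k<0$ or $k>n$. Given real sequences $a_0(n),a_1(n)$, put $a(x,n)=a_1(n)x+a_0(n)$ and, for $n\ge 1$, $$p_{n,k}^{M,1}(x)=a(x,n)\,p_{n-1,k}(x)+a(1-x,n)\,p_{n-1,k-1}(x),\quad 0\le k\le n$$ (so $p_{n,0}^{M,1}(x)=a(x,n)(1-x)^{n-1}$ and $p_{n,n}^{M,1}(x)=a(1-x,n)x^{n-1}$). The operator $D_n^{M,1}$ is $$D_n^{M,1}(f;x)=(n+1)\sum_{k=0}^{n}p_{n,k}^{M,1}(x)\int_0^1 p_{n,k}(t)f(t)\,dt,\quad x\in[0,1].$$ *)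

(* Defs.v *)
From Stdlib Require Import Reals ZArith.
From Coquelicot Require Import Coquelicot.
Open Scope R_scope.

Definition unit_interval (t : R) : Prop := 0 <= t <= 1.

(* The range test is needed: [Binomial.C n k] is not 0 for [k > n]. *)
Definition bernstein (n : nat) (k : Z) (x : R) : R :=
  if ((0 <=? k) && (k <=? Z.of_nat n))%Z%bool
  then Binomial.C n (Z.to_nat k) * x ^ Z.to_nat k * (1 - x) ^ (n - Z.to_nat k)
  else 0.

Definition acoef (a0 a1 : nat -> R) (x : R) (n : nat) : R := a1 n * x + a0 n.

(* Meaningful for [n >= 1] only, since [pred 0 = 0]. *)
Definition bernsteinM1 (a0 a1 : nat -> R) (n : nat) (k : Z) (x : R) : R :=
  acoef a0 a1 x n * bernstein (pred n) k x
  + acoef a0 a1 (1 - x) n * bernstein (pred n) (k - 1) x.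

Definition DM1 (a0 a1 : nat -> R) (n : nat) (f : R -> R) (x : R) : R :=
  (INR n + 1) *
  sum_f_R0 (fun k => bernsteinM1 a0 a1 n (Z.of_nat k) x *
                     RInt (fun t => bernstein n (Z.of_nat k) t * f t) 0 1) n.

(* Derivatives are taken relative to [0,1], hence one-sided at 0 and 1;
   values of [f] outside [0,1] play no role. *)
Definition derivative_on_unit_at (f f1 : R -> R) (x : R) : Prop :=
  D_in f f1 unit_interval x.

Definition second_derivative_at (f f1 : R -> R) (x d2 : R) : Prop :=
  within unit_interval (locally x) (fun y => derivative_on_unit_at f f1 y) /\
  derivative_on_unit_at f1 (fun _ => d2) x.

(* Main.v *)
Require Import Defs.
From Stdlib Require Import Reals ZArith Lra Lia.
From Coquelicot Require Import Coquelicot.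
Open Scope R_scope.

(** The operator is a two-term combination of positive ones.  Put m = n - 1, let
    h k be the mean of f against the density (n+1) p_(n,k), and let B_m be the
    Bernstein sum of degree m.  Since p^(M,1)_(n,k) only involves p_(m,k) and
    p_(m,k-1), the value of the operator is a(x,n) B_m(h) + a(1-x,n) B_m(h o S)
    ([DM1_adjacent_mean]), where S is the successor.  The weights a(x,n) and
    a(1-x,n) add up to 2 a_0 + a_1 = 1; they may be negative, but they stay
    bounded, so the operator is dominated, up to a constant A, by the positive
    functional P = B_m(h) + B_m(h o S) ([adjacent_mean_abs_le]).

    Both kinds of moments are explicit.  The rule
    t p_(n,k)(t) = (k+1)/(n+1) p_(n+1,k+1)(t) gives the means of polynomials
    ([bernstein_mean_quartic]) in terms of rising factorials of k, and Pascal's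
    rule gives the Bernstein sums of these ([bernstein_sum_rising]).  So, up to
    O(1/n), n times the first and second central moments of the operator are
    (1-2x)(2 a_1 + 3 a_0) and 2x(1-x), while n P((t-x)^2) is bounded and
    n P((t-x)^4) is O(1/n) ([adjacent_mean_even_le]).

    It remains to write f as its second-order Taylor polynomial at x plus a
    remainder r.  Near x, |r(t)| <= e (t-x)^2 with e as small as desired; away
    from x, r is bounded and hence at most K (t-x)^4.  Therefore n times the
    operator applied to r is at most A (2e + O(K/n)), and the limit follows
    ([voronovskaja_of_remainder]).  If f'' exists at the point x only, K may
    depend on x ([pointwise_remainder]); if f'' is continuous on [0,1], then its
    uniform continuity gives one K for all x ([uniform_remainder]), and all the
    estimates become uniform. *)

(** * Bernstein polynomials *)

Lemma bernstein_neg n k x : (k < 0)%Z -> bernstein n k x = 0.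
Proof.
intros Hk; unfold bernstein.
replace (0 <=? k)%Z with false by (symmetry; apply Z.leb_gt; lia); reflexivity.
Qed.

Lemma bernstein_gt n k x : (Z.of_nat n < k)%Z -> bernstein n k x = 0.
Proof.
intros Hk; unfold bernstein.
replace (k <=? Z.of_nat n)%Z with false by (symmetry; apply Z.leb_gt; lia).
rewrite Bool.andb_false_r; reflexivity.
Qed.

Lemma bernstein_nat n k x : (k <= n)%nat ->
  bernstein n (Z.of_nat k) x = Binomial.C n k * x ^ k * (1 - x) ^ (n - k).
Proof.
intros Hk; unfold bernstein.
replace (0 <=? Z.of_nat k)%Z with true by (symmetry; apply Z.leb_le; lia).
replace (Z.of_nat k <=? Z.of_nat n)%Z with true
  by (symmetry; apply Z.leb_le; lia).
rewrite Nat2Z.id; reflexivity.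
Qed.

Lemma bernstein_pascal n k x :
  bernstein (S n) k x = (1 - x) * bernstein n k x + x * bernstein n (k - 1) x.
Proof.
destruct (Z_lt_le_dec k 0) as [Hk|Hk].
  rewrite !bernstein_neg by lia; ring.
destruct (Z_of_nat_complete k Hk) as [j ->].
destruct j as [|j].
  rewrite (bernstein_neg n (_ - 1)) by lia.
  rewrite !bernstein_nat by lia.
  rewrite !C_n_0, !Nat.sub_0_r; simpl; ring.
replace (Z.of_nat (S j) - 1)%Z with (Z.of_nat j) by lia.
destruct (Nat.lt_trichotomy j n) as [Hj|[->|Hj]].
- rewrite !bernstein_nat by lia.
  rewrite <- (pascal n j Hj).
  replace (S n - S j)%nat with (S (n - S j)) by lia.
  replace (n - j)%nat with (S (n - S j)) by lia.
  simpl; ring.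
- rewrite (bernstein_gt n (Z.of_nat (S n))) by lia.
  rewrite !bernstein_nat by lia.
  rewrite !C_n_n, !Nat.sub_diag; simpl; ring.
- rewrite !bernstein_gt by lia; ring.
Qed.

Lemma bernstein_ge0 n k x : unit_interval x -> 0 <= bernstein n k x.
Proof.
intros [H0 H1]; revert k; induction n as [|n IH]; intros k.
- destruct (Z.eq_dec k 0) as [->|Hk].
    rewrite (bernstein_nat 0 0) by lia; rewrite C_n_0; simpl; lra.
  destruct (Z_lt_le_dec k 0).
    rewrite bernstein_neg by lia; lra.
  rewrite bernstein_gt by lia; lra.
- rewrite bernstein_pascal.
  apply Rplus_le_le_0_compat; apply Rmult_le_pos; auto; lra.
Qed.

(** Multiplication by x raises degree and index together; iterating this turns
    every moment of p_(n,k) into the total mass of another p_(n',k'), so that no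
    Beta integral is needed. *)
Lemma bernstein_raise n k x : (k <= n)%nat ->
  x * bernstein n (Z.of_nat k) x
  = (INR k + 1) / (INR n + 1) * bernstein (S n) (Z.of_nat (S k)) x.
Proof.
intros Hk; rewrite !bernstein_nat by lia.
replace (S n - S k)%nat with (n - k)%nat by lia.
unfold Binomial.C; replace (S n - S k)%nat with (n - k)%nat by lia.
rewrite !fact_simpl, !mult_INR, !S_INR; simpl pow; field.
pose proof (pos_INR n); pose proof (pos_INR k).
repeat split; try apply INR_fact_neq_0; lra.
Qed.

(** The index ranges over all integers, so the formula has no boundary cases, and
    the induction is a direct consequence of Pascal's rule. *)
Lemma is_derive_bernstein n k x :
  is_derive (bernstein (S n) k) x
    ((INR n + 1) * (bernstein n (k - 1) x - bernstein n k x)).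
Proof.
revert k x; induction n as [|n IH]; intros k x.
- assert (H0 : forall j y, bernstein 0 j y = bernstein 0 j 0).
    intros j y; destruct (Z.eq_dec j 0) as [->|Hj].
      rewrite !(bernstein_nat 0 0) by lia; simpl; ring.
    destruct (Z_lt_le_dec j 0).
      rewrite !bernstein_neg by lia; reflexivity.
    rewrite !bernstein_gt by lia; reflexivity.
  apply is_derive_ext with
    (fun y => (1 - y) * bernstein 0 k 0 + y * bernstein 0 (k - 1) 0).
    intros y; rewrite bernstein_pascal, (H0 k y), (H0 (k - 1)%Z y); reflexivity.
  rewrite (H0 k x), (H0 (k - 1)%Z x).
  auto_derive; [exact I|simpl; ring].
- apply is_derive_ext with
    (fun y => (1 - y) * bernstein (S n) k y + y * bernstein (S n) (k - 1) y).
    intros y; rewrite (bernstein_pascal (S n)); reflexivity.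
  evar_last.
    apply (is_derive_plus (fun y => (1 - y) * bernstein (S n) k y)
                          (fun y => y * bernstein (S n) (k - 1) y)).
      apply (is_derive_mult (fun y => 1 - y) (bernstein (S n) k) x (-1)).
        auto_derive; [exact I|ring].
        apply IH.
      exact Rmult_comm.
    apply (is_derive_mult (fun y => y) (bernstein (S n) (k - 1)) x 1).
      auto_derive; [exact I|ring].
      apply IH.
    exact Rmult_comm.
  unfold plus, mult; simpl plus; simpl mult.
  rewrite S_INR, !(bernstein_pascal n); cbn -[INR]; ring.
Qed.

Lemma continuous_bernstein n k x : continuous (bernstein n k) x.
Proof.
destruct n as [|n].
- apply continuous_ext with (fun _ => bernstein 0 k 0).
    intros y; unfold bernstein; destruct (_ && _)%bool eqn:E; [|reflexivity].
    apply andb_prop in E; destruct E as [E1 E2].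
    apply Z.leb_le in E1; apply Z.leb_le in E2.
    replace k with 0%Z by lia; simpl; ring.
  apply continuous_const.
- apply (ex_derive_continuous (V := R_NormedModule)); eexists; apply is_derive_bernstein.
Qed.

Lemma ex_RInt_bernstein n k f : (forall t, continuous f t) ->
  ex_RInt (fun t => bernstein n k t * f t) 0 1.
Proof.
intros Hf; apply (ex_RInt_continuous (V := R_CompleteNormedModule)); intros z _.
apply (continuous_mult (bernstein n k) f); [apply continuous_bernstein|apply Hf].
Qed.

(** The integral of the derivative of p_(n+1,j) is its increment over [0,1],
    which is 0 for 0 < j <= n and -1 for j = 0.  By [is_derive_bernstein], the
    first fact says that consecutive p_(n,k) have the same mass, and the second
    one gives the mass of p_(n,0). *)
Lemma RInt_bernstein n k : (k <= n)%nat ->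
  RInt (bernstein n (Z.of_nat k)) 0 1 = / (INR n + 1).
Proof.
pose proof (pos_INR n) as Hn.
assert (Hex : forall j, ex_RInt (bernstein n j) 0 1).
  intros j; apply (ex_RInt_continuous (V := R_CompleteNormedModule)); intros z _.
  apply continuous_bernstein.
(* The integral of the derivative of p_(n+1,j), computed in two ways. *)
assert (HI : forall j, (INR n + 1) * (RInt (bernstein n (j - 1)) 0 1
    - RInt (bernstein n j) 0 1) = bernstein (S n) j 1 - bernstein (S n) j 0).
  intros j.
  assert (H1 : is_RInt (fun t => (INR n + 1) *
      (bernstein n (j - 1) t - bernstein n j t)) 0 1
      (bernstein (S n) j 1 - bernstein (S n) j 0)).
    apply (is_RInt_derive (V := R_CompleteNormedModule) (bernstein (S n) j)).
      intros y _; apply is_derive_bernstein.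
    intros y _.
    apply (continuous_scal_r (V := R_NormedModule) (INR n + 1)
      (fun t => bernstein n (j - 1) t - bernstein n j t)).
    apply (continuous_minus (V := R_NormedModule)); apply continuous_bernstein.
  assert (H2 : is_RInt (fun t => (INR n + 1) *
      (bernstein n (j - 1) t - bernstein n j t)) 0 1
      ((INR n + 1) * (RInt (bernstein n (j - 1)) 0 1
        - RInt (bernstein n j) 0 1))).
    apply (is_RInt_scal (V := R_NormedModule)).
    apply (is_RInt_minus (V := R_NormedModule));
      apply (RInt_correct (V := R_CompleteNormedModule)), Hex.
  apply (is_RInt_unique (V := R_CompleteNormedModule)) in H1.
  apply (is_RInt_unique (V := R_CompleteNormedModule)) in H2.
  rewrite <- H1, <- H2; reflexivity.
induction k as [|k IH]; intros Hk.
- specialize (HI 0%Z).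
  rewrite (RInt_ext (bernstein n (0 - 1)) (fun _ => 0)) in HI
    by (intros; apply bernstein_neg; lia).
  rewrite RInt_const in HI.
  rewrite !(bernstein_nat (S n) 0) in HI by lia.
  rewrite C_n_0, Nat.sub_0_r, Rminus_diag, pow_ne_zero, Rminus_0_r in HI
    by lia.
  unfold scal in HI; simpl in HI; unfold mult in HI; simpl in HI.
  apply Rmult_eq_reg_l with (INR n + 1); [|lra].
  rewrite pow1 in HI.
  rewrite Rinv_r by lra; change (Z.of_nat 0) with 0%Z; lra.
- specialize (HI (Z.of_nat (S k))).
  replace (Z.of_nat (S k) - 1)%Z with (Z.of_nat k) in HI by lia.
  rewrite IH in HI by lia.
  rewrite !(bernstein_nat (S n) (S k)) in HI by lia.
  rewrite Rminus_diag, (pow_ne_zero (S n - S k)), (pow_ne_zero (S k)) in HI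
    by lia.
  rewrite !Rmult_0_r, !Rmult_0_l, Rminus_0_r in HI.
  apply Rmult_integral in HI; destruct HI; lra.
Qed.

(** * Moments of the Bernstein densities *)

Definition bernstein_mean (n k : nat) (g : R -> R) : R :=
  (INR n + 1) * RInt (fun t => bernstein n (Z.of_nat k) t * g t) 0 1.

Lemma bernstein_mean_ext n k g h : (forall t, unit_interval t -> g t = h t) ->
  bernstein_mean n k g = bernstein_mean n k h.
Proof.
intros H; unfold bernstein_mean; f_equal; apply RInt_ext; intros t Ht.
rewrite Rmin_left, Rmax_right in Ht by lra.
rewrite H; [reflexivity|unfold unit_interval; lra].
Qed.

Lemma bernstein_mean_plus n k g h :
  (forall t, continuous g t) -> (forall t, continuous h t) ->
  bernstein_mean n k (fun t => g t + h t)
  = bernstein_mean n k g + bernstein_mean n k h.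
Proof.
intros Hg Hh; unfold bernstein_mean; rewrite <- Rmult_plus_distr_l; f_equal.
rewrite <- (RInt_plus (V := R_CompleteNormedModule))
  by (apply ex_RInt_bernstein; assumption).
apply RInt_ext; intros t _; unfold plus; simpl; ring.
Qed.

Lemma bernstein_mean_abs_le n k g h :
  (forall t, continuous g t) -> (forall t, continuous h t) ->
  (forall t, unit_interval t -> Rabs (g t) <= h t) ->
  Rabs (bernstein_mean n k g) <= bernstein_mean n k h.
Proof.
intros Hg Hh Hgh; unfold bernstein_mean; pose proof (pos_INR n) as Hn.
rewrite Rabs_mult, (Rabs_pos_eq (INR n + 1)) by lra.
apply Rmult_le_compat_l; [lra|].
apply (norm_RInt_le (V := R_NormedModule)
  (fun t => bernstein n (Z.of_nat k) t * g t)
  (fun t => bernstein n (Z.of_nat k) t * h t) 0 1); [lra| | |].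
- intros t Ht; change (norm (bernstein n (Z.of_nat k) t * g t))
    with (Rabs (bernstein n (Z.of_nat k) t * g t)).
  rewrite Rabs_mult, Rabs_pos_eq by (apply bernstein_ge0; exact Ht).
  apply Rmult_le_compat_l; [apply bernstein_ge0; exact Ht|apply Hgh; exact Ht].
- apply (RInt_correct (V := R_CompleteNormedModule)), ex_RInt_bernstein, Hg.
- apply (RInt_correct (V := R_CompleteNormedModule)), ex_RInt_bernstein, Hh.
Qed.

(** One step of Horner's scheme: applied repeatedly, it computes the mean of any
    polynomial from [RInt_bernstein] and [bernstein_raise] alone. *)
Lemma bernstein_mean_horner n k c g : (k <= n)%nat ->
  (forall t, continuous g t) ->
  bernstein_mean n k (fun t => c + t * g t)
  = c + (INR k + 1) / (INR n + 2) * bernstein_mean (S n) (S k) g.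
Proof.
intros Hk Hg; pose proof (pos_INR n) as Hn.
rewrite (bernstein_mean_plus n k (fun _ => c) (fun t => t * g t)).
2: intros t; apply continuous_const.
2: intros t; apply (continuous_mult (fun t => t) g);
   [apply continuous_id|apply Hg].
unfold bernstein_mean; f_equal.
- rewrite (RInt_ext _ (fun t => scal c (bernstein n (Z.of_nat k) t)))
    by (intros; unfold scal; simpl; unfold mult; simpl; ring).
  rewrite (RInt_scal (V := R_CompleteNormedModule)), RInt_bernstein by
    (assumption || apply (ex_RInt_continuous (V := R_CompleteNormedModule));
     intros; apply continuous_bernstein).
  unfold scal; simpl; unfold mult; simpl; field; lra.
- rewrite (RInt_ext _ (fun t => scal ((INR k + 1) / (INR n + 1))
      (bernstein (S n) (Z.of_nat (S k)) t * g t))).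
    rewrite (RInt_scal (V := R_CompleteNormedModule))
      by (apply ex_RInt_bernstein, Hg).
    rewrite S_INR; unfold scal; simpl; unfold mult; simpl; field; lra.
  intros t _; unfold scal; simpl; unfold mult; simpl.
  rewrite (Rmult_comm (bernstein n (Z.of_nat k) t)), Rmult_assoc.
  rewrite (Rmult_comm (g t)), <- Rmult_assoc, bernstein_raise by assumption.
  rewrite Rmult_assoc; reflexivity.
Qed.

(** * Moments of Bernstein sums *)

Definition bernstein_sum (m : nat) (h : nat -> R) (x : R) : R :=
  sum_f_R0 (fun k => bernstein m (Z.of_nat k) x * h k) m.

Lemma bernstein_sum_ext m h h' x : (forall k, (k <= m)%nat -> h k = h' k) ->
  bernstein_sum m h x = bernstein_sum m h' x.
Proof.
intros H; apply sum_eq; intros k Hk; rewrite H by exact Hk; reflexivity.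
Qed.

Lemma bernstein_sum_plus m h h' x :
  bernstein_sum m (fun k => h k + h' k) x
  = bernstein_sum m h x + bernstein_sum m h' x.
Proof.
unfold bernstein_sum; rewrite <- sum_plus; apply sum_eq; intros; ring.
Qed.

Lemma bernstein_sum_abs_le m h h' x : unit_interval x ->
  (forall k, (k <= m)%nat -> Rabs (h k) <= h' k) ->
  Rabs (bernstein_sum m h x) <= bernstein_sum m h' x.
Proof.
intros Hx H; eapply Rle_trans; [apply Rsum_abs|].
apply sum_Rle; intros k Hk.
rewrite Rabs_mult, Rabs_pos_eq by (apply bernstein_ge0; exact Hx).
apply Rmult_le_compat_l; [apply bernstein_ge0; exact Hx|apply H; exact Hk].
Qed.

(** Both Pascal's rule and the definition of p^(M,1) combine p_(m,k) with
    p_(m,k-1); p_(m,m+1) = p_(m,-1) = 0 and a shift of the index reduce the two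
    cases to sums of degree m. *)
Lemma sum_adjacent_bernstein m h u v x :
  sum_f_R0 (fun k => (u * bernstein m (Z.of_nat k) x
                      + v * bernstein m (Z.of_nat k - 1) x) * h k) (S m)
  = u * bernstein_sum m h x + v * bernstein_sum m (fun k => h (S k)) x.
Proof.
rewrite (sum_eq _ (fun k => u * (bernstein m (Z.of_nat k) x * h k)
                  + v * (bernstein m (Z.of_nat k - 1) x * h k)))
  by (intros; ring).
rewrite sum_plus; f_equal.
- rewrite tech5, bernstein_gt by lia.
  rewrite Rmult_0_l, Rmult_0_r, Rplus_0_r.
  unfold bernstein_sum; rewrite scal_sum; apply sum_eq; intros; ring.
- rewrite decomp_sum by lia.
  rewrite bernstein_neg by lia.
  rewrite Rmult_0_l, Rmult_0_r, Rplus_0_l.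
  unfold bernstein_sum; rewrite scal_sum; apply sum_eq; intros i _.
  replace (Z.of_nat (S i) - 1)%Z with (Z.of_nat i) by lia; ring.
Qed.

Lemma bernstein_sum_S m h x :
  bernstein_sum (S m) h x
  = (1 - x) * bernstein_sum m h x + x * bernstein_sum m (fun k => h (S k)) x.
Proof.
rewrite <- sum_adjacent_bernstein; apply sum_eq; intros k _.
rewrite bernstein_pascal; reflexivity.
Qed.

(** Rising factorials of k are what [bernstein_mean_quartic] produces; their sums
    follow from Vandermonde's identity and the falling factorial moments
    M(M-1)...(M-j+1) x^j of the binomial distribution.  The shift s is there for
    the induction on m, in which [bernstein_sum_S] replaces s by s + 1. *)
Lemma bernstein_sum_rising m x s e0 e1 e2 e3 e4 :
  bernstein_sum m (fun k => let y := INR k + s in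
    e0 + (y + 1) * (e1 + (y + 2) * (e2 + (y + 3) * (e3 + (y + 4) * e4)))) x
  = let M := INR m in
    e0 + e1 * (s + 1 + M * x)
    + e2 * ((s + 1) * (s + 2) + 2 * M * x * (s + 2) + M * (M - 1) * x ^ 2)
    + e3 * ((s + 1) * (s + 2) * (s + 3) + 3 * M * x * (s + 2) * (s + 3)
            + 3 * M * (M - 1) * x ^ 2 * (s + 3)
            + M * (M - 1) * (M - 2) * x ^ 3)
    + e4 * ((s + 1) * (s + 2) * (s + 3) * (s + 4)
            + 4 * M * x * (s + 2) * (s + 3) * (s + 4)
            + 6 * M * (M - 1) * x ^ 2 * (s + 3) * (s + 4)
            + 4 * M * (M - 1) * (M - 2) * x ^ 3 * (s + 4)
            + M * (M - 1) * (M - 2) * (M - 3) * x ^ 4).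
Proof.
revert s; induction m as [|m IH]; intros s.
- unfold bernstein_sum; simpl sum_f_R0.
  rewrite (bernstein_nat 0 0) by lia; rewrite C_n_0; simpl; ring.
- rewrite bernstein_sum_S, IH.
  rewrite (bernstein_sum_ext m _ (fun k => let y := INR k + (s + 1) in
    e0 + (y + 1) * (e1 + (y + 2) * (e2 + (y + 3) * (e3 + (y + 4) * e4)))))
    by (intros; cbv zeta; rewrite S_INR; ring).
  rewrite IH, S_INR; cbv zeta; ring.
Qed.

(** * The operator as a combination of two positive functionals *)

Lemma continuous_horner c g : (forall t, continuous g t) ->
  forall t, continuous (fun t => c + t * g t) t.
Proof.
intros Hg t; apply (continuous_plus (fun _ => c) (fun t => t * g t)).
  apply continuous_const.
apply (continuous_mult (fun t => t) g); [apply continuous_id|apply Hg].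
Qed.

Lemma bernstein_mean_quartic n k d0 d1 d2 d3 d4 : (k <= n)%nat ->
  bernstein_mean n k
    (fun t => d0 + t * (d1 + t * (d2 + t * (d3 + t * (d4 + t * 0)))))
  = let y := INR k in let N := INR n in
    d0 + (y + 1) / (N + 2) * (d1 + (y + 2) / (N + 3) * (d2
       + (y + 3) / (N + 4) * (d3 + (y + 4) / (N + 5) * d4))).
Proof.
intros Hk; pose proof (pos_INR n).
rewrite !bernstein_mean_horner by
  (try lia; repeat apply continuous_horner; intros; apply continuous_const).
rewrite !S_INR; cbv zeta.
match goal with |- context [bernstein_mean ?a ?b (fun _ => 0)] =>
  replace (bernstein_mean a b (fun _ => 0)) with 0 end.
  field; lra.
unfold bernstein_mean; rewrite (RInt_ext _ (fun _ => 0)) by (intros; apply Rmult_0_r).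
rewrite RInt_const; unfold scal; simpl; unfold mult; simpl; ring.
Qed.

(** Keeping the weights a and b free allows one functional to serve both as the
    operator (a = a(x,n), b = a(1-x,n)) and as its positive majorant
    (a = b = 1). *)
Definition adjacent_mean (a b : R) (m : nat) (g : R -> R) (x : R) : R :=
  a * bernstein_sum m (fun k => bernstein_mean (S m) k g) x
  + b * bernstein_sum m (fun k => bernstein_mean (S m) (S k) g) x.

Lemma DM1_adjacent_mean a0 a1 m f x :
  DM1 a0 a1 (S m) f x
  = adjacent_mean (acoef a0 a1 x (S m)) (acoef a0 a1 (1 - x) (S m)) m f x.
Proof.
unfold DM1, adjacent_mean; rewrite <- sum_adjacent_bernstein, scal_sum.
apply sum_eq; intros k _; unfold bernsteinM1, bernstein_mean; simpl pred; ring.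
Qed.

Lemma adjacent_mean_ext a b m g h x :
  (forall t, unit_interval t -> g t = h t) ->
  adjacent_mean a b m g x = adjacent_mean a b m h x.
Proof.
intros H; unfold adjacent_mean; f_equal; f_equal; apply bernstein_sum_ext;
  intros k _; apply bernstein_mean_ext, H.
Qed.

Lemma adjacent_mean_plus a b m g h x :
  (forall t, continuous g t) -> (forall t, continuous h t) ->
  adjacent_mean a b m (fun t => g t + h t) x
  = adjacent_mean a b m g x + adjacent_mean a b m h x.
Proof.
intros Hg Hh; unfold adjacent_mean.
rewrite (bernstein_sum_ext m (fun k => bernstein_mean (S m) k _)
  (fun k => bernstein_mean (S m) k g + bernstein_mean (S m) k h))
  by (intros; apply bernstein_mean_plus; assumption).
rewrite (bernstein_sum_ext m (fun k => bernstein_mean (S m) (S k) _)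
  (fun k => bernstein_mean (S m) (S k) g + bernstein_mean (S m) (S k) h))
  by (intros; apply bernstein_mean_plus; assumption).
rewrite !bernstein_sum_plus; ring.
Qed.

(** This substitutes for the positivity of the operator, whose weights may have
    either sign. *)
Lemma adjacent_mean_abs_le a b A m g h x : unit_interval x ->
  Rabs a <= A -> Rabs b <= A ->
  (forall t, continuous g t) -> (forall t, continuous h t) ->
  (forall t, unit_interval t -> Rabs (g t) <= h t) ->
  Rabs (adjacent_mean a b m g x) <= A * adjacent_mean 1 1 m h x.
Proof.
intros Hx Ha Hb Hg Hh Hgh; unfold adjacent_mean.
eapply Rle_trans; [apply Rabs_triang|].
rewrite !Rabs_mult, !Rmult_1_l, Rmult_plus_distr_l.
apply Rplus_le_compat; apply Rmult_le_compat; try apply Rabs_pos; try assumption;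
  apply bernstein_sum_abs_le; try assumption; intros;
  apply bernstein_mean_abs_le; assumption.
Qed.

(** Degree 4 is what (t-x)^4 requires.  The index shift j is 0 or 1 for the two
    terms of the operator; j <= 1 keeps j + k within the degree m + 1. *)
Lemma bernstein_sum_mean_quartic m j x d0 d1 d2 d3 d4 : (j <= 1)%nat ->
  bernstein_sum m (fun k => bernstein_mean (S m) (j + k)
    (fun t => d0 + t * (d1 + t * (d2 + t * (d3 + t * (d4 + t * 0)))))) x
  = let M := INR m in let s := INR j in
    d0 + d1 * (s + 1 + M * x) / (M + 3)
    + d2 * ((s + 1) * (s + 2) + 2 * M * x * (s + 2) + M * (M - 1) * x ^ 2)
      / ((M + 3) * (M + 4))
    + d3 * ((s + 1) * (s + 2) * (s + 3) + 3 * M * x * (s + 2) * (s + 3)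
            + 3 * M * (M - 1) * x ^ 2 * (s + 3)
            + M * (M - 1) * (M - 2) * x ^ 3)
      / ((M + 3) * (M + 4) * (M + 5))
    + d4 * ((s + 1) * (s + 2) * (s + 3) * (s + 4)
            + 4 * M * x * (s + 2) * (s + 3) * (s + 4)
            + 6 * M * (M - 1) * x ^ 2 * (s + 3) * (s + 4)
            + 4 * M * (M - 1) * (M - 2) * x ^ 3 * (s + 4)
            + M * (M - 1) * (M - 2) * (M - 3) * x ^ 4)
      / ((M + 3) * (M + 4) * (M + 5) * (M + 6)).
Proof.
intros Hj; pose proof (pos_INR m) as Hm; cbv zeta.
rewrite (bernstein_sum_ext _ _ (fun k => let y := INR k + INR j in
  d0 + (y + 1) * (d1 / (INR m + 3) + (y + 2) * (d2 / ((INR m + 3) * (INR m + 4))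
  + (y + 3) * (d3 / ((INR m + 3) * (INR m + 4) * (INR m + 5))
  + (y + 4) * (d4 / ((INR m + 3) * (INR m + 4) * (INR m + 5) * (INR m + 6)))))))).
- rewrite bernstein_sum_rising; cbv zeta; field; lra.
- intros k Hk; rewrite bernstein_mean_quartic by lia.
  cbv zeta; rewrite plus_INR, S_INR; field; lra.
Qed.

(** The image of a Taylor polynomial at x, from which the limit is read off. *)
Lemma adjacent_mean_quadratic a b m c p q x :
  adjacent_mean a b m (fun t => c + p * (t - x) + q * (t - x) ^ 2) x
  = let M := INR m in let X := x * (1 - x) in
    c * (a + b)
    + p * ((a * (1 - 3 * x) + b * (2 - 3 * x)) / (M + 3))
    + q * ((2 * M * X * (a + b) + a * (2 - 8 * x + 12 * x ^ 2)
            + b * (6 - 16 * x + 12 * x ^ 2)) / ((M + 3) * (M + 4))).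
Proof.
rewrite (adjacent_mean_ext _ _ _ _ (fun t => (c - p * x + q * x ^ 2) + t *
  ((p - 2 * q * x) + t * (q + t * (0 + t * (0 + t * 0)))))) by (intros; ring).
unfold adjacent_mean; pose proof (pos_INR m).
rewrite (bernstein_sum_mean_quartic m 0), (bernstein_sum_mean_quartic m 1) by lia.
simpl INR; cbv zeta; field; lra.
Qed.

(** The weights 1, 1 are exchanged by the symmetry x -> 1-x, which is why the
    even central moments depend on x through x(1-x) only.  In the fourth one the
    terms in M^4 and M^3 cancel. *)
Lemma adjacent_mean_even m c2 c4 x :
  adjacent_mean 1 1 m (fun t => c2 * (t - x) ^ 2 + c4 * (t - x) ^ 4) x
  = let M := INR m in let X := x * (1 - x) in
    c2 * ((4 * M * X + 8 - 24 * X) / ((M + 3) * (M + 4)))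
    + c4 * ((24 * M ^ 2 * X ^ 2 + M * (216 * X - 744 * X ^ 2)
             + 144 - 720 * X + 720 * X ^ 2)
            / ((M + 3) * (M + 4) * (M + 5) * (M + 6))).
Proof.
rewrite (adjacent_mean_ext _ _ _ _ (fun t => (c2 * x ^ 2 + c4 * x ^ 4) + t *
  ((- 2 * c2 * x - 4 * c4 * x ^ 3) + t * ((c2 + 6 * c4 * x ^ 2)
   + t * (- 4 * c4 * x + t * (c4 + t * 0)))))) by (intros; ring).
unfold adjacent_mean; pose proof (pos_INR m).
rewrite (bernstein_sum_mean_quartic m 0), (bernstein_sum_mean_quartic m 1) by lia.
simpl INR; cbv zeta; field; lra.
Qed.

(** The decay of the second and fourth moments, of orders 1/n and 1/n^2, is what
    controls the remainder; 2 and 200 are convenient constants, far from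
    sharp. *)
Lemma adjacent_mean_even_le m x c2 c4 : unit_interval x -> 0 <= c2 -> 0 <= c4 ->
  (INR m + 1) *
    adjacent_mean 1 1 m (fun t => c2 * (t - x) ^ 2 + c4 * (t - x) ^ 4) x
  <= 2 * c2 + 200 * c4 / (INR m + 1).
Proof.
intros [H0 H1] Hc2 Hc4; rewrite adjacent_mean_even; cbv zeta.
set (M := INR m); set (X := x * (1 - x)).
assert (HM : 0 <= M) by apply pos_INR.
assert (HX : 0 <= X <= 1 / 4).
  pose proof (pow2_ge_0 (x - 1 / 2)); unfold X; split; nra.
assert (HMX : 0 <= M * X <= M / 4) by nra.
assert (HX2 : 0 <= X ^ 2 <= 1 / 16) by nra.
assert (HMX2 : 0 <= M * X ^ 2) by nra.
assert (HMM : 0 <= M ^ 2 * X ^ 2 <= M ^ 2) by nra.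
assert (B2 : (M + 1) * ((4 * M * X + 8 - 24 * X) / ((M + 3) * (M + 4))) <= 2).
  apply Rmult_le_reg_r with ((M + 3) * (M + 4)); [nra|].
  field_simplify; [|lra]; nra.
assert (B4 : (M + 1) * ((24 * M ^ 2 * X ^ 2 + M * (216 * X - 744 * X ^ 2)
             + 144 - 720 * X + 720 * X ^ 2)
            / ((M + 3) * (M + 4) * (M + 5) * (M + 6))) <= 200 / (M + 1)).
  apply Rle_trans with ((M + 1) * (200 * (M + 1) ^ 2 / (M + 1) ^ 4)).
  2: right; field; lra.
  apply Rmult_le_compat_l; [lra|].
  assert (Hd : (M + 1) ^ 4 <= (M + 3) * (M + 4) * (M + 5) * (M + 6)).
    replace ((M + 1) ^ 4) with ((M + 1) * (M + 1) * (M + 1) * (M + 1)) by ring.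
    repeat apply Rmult_le_compat; try lra; repeat apply Rmult_le_pos; lra.
  assert (Hp : 0 < (M + 1) ^ 4) by (apply pow_lt; lra).
  apply Rle_trans with
    (200 * (M + 1) ^ 2 / ((M + 3) * (M + 4) * (M + 5) * (M + 6))).
    apply Rmult_le_compat_r; [left; apply Rinv_0_lt_compat; lra|nra].
  apply Rmult_le_compat_l; [nra|].
  apply Rinv_le_contravar; lra.
replace (2 * c2 + 200 * c4 / (M + 1))
  with (c2 * 2 + c4 * (200 / (M + 1))) by (field; lra).
rewrite Rmult_plus_distr_l; apply Rplus_le_compat;
  rewrite <- Rmult_assoc, (Rmult_comm (M + 1)), Rmult_assoc;
  apply Rmult_le_compat_l; assumption.
Qed.

(** * Functions on [0,1] and their Taylor remainders *)

(** Composing with the retraction of the line onto [0,1] makes a function that is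
    continuous on [0,1] continuous everywhere without changing it on [0,1], so
    that results on integration and the mean value theorem apply. *)
Definition clamp (t : R) : R := Rmax 0 (Rmin 1 t).

Lemma clamp_unit t : unit_interval (clamp t).
Proof.
unfold unit_interval, clamp, Rmax, Rmin; repeat destruct Rle_dec; lra.
Qed.

Lemma clamp_id t : unit_interval t -> clamp t = t.
Proof.
unfold unit_interval, clamp, Rmax, Rmin; intros; repeat destruct Rle_dec; lra.
Qed.

Lemma clamp_lipschitz s t : Rabs (clamp t - clamp s) <= Rabs (t - s).
Proof.
unfold clamp, Rmax, Rmin, Rabs;
  repeat destruct Rle_dec; repeat destruct Rcase_abs; lra.
Qed.

Lemma continuous_clamp (f : R -> R) : continuous_on unit_interval f ->
  forall t, continuous (fun s => f (clamp s)) t.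
Proof.
intros Hf t.
apply filterlim_comp with (2 := Hf (clamp t) (clamp_unit t)).
intros P [d Hd]; exists d; intros y Hy.
apply Hd; [|apply clamp_unit].
eapply Rle_lt_trans; [apply clamp_lipschitz|exact Hy].
Qed.

Lemma continuous_on_unit_bounded (f : R -> R) : continuous_on unit_interval f ->
  exists B, 0 <= B /\ forall t, unit_interval t -> Rabs (f t) <= B.
Proof.
intros Hf.
destruct (continuity_ab_maj (fun t => Rabs (f (clamp t))) 0 1) as [z [Hz _]].
- lra.
- intros c _; apply continuity_pt_filterlim.
  apply (continuous_comp (fun t => f (clamp t)) Rabs).
    apply continuous_clamp, Hf.
  apply continuous_Rabs.
- exists (Rabs (f (clamp z))); split; [apply Rabs_pos|].
  intros t Ht; rewrite <- (clamp_id t Ht) at 1; apply Hz, Ht.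
Qed.

Lemma D_in_continuous_on (f f1 : R -> R) :
  (forall x, unit_interval x -> derivative_on_unit_at f f1 x) ->
  continuous_on unit_interval f.
Proof.
intros H x Hx P [e He].
destruct (cont_deriv _ _ _ _ (H x Hx) e (cond_pos e)) as [d [Hd Hc]].
exists (mkposreal d Hd); intros y Hy Uy; apply He.
destruct (Req_dec x y) as [<-|Hxy]; [apply ball_center|].
apply Hc; split; [split; assumption|exact Hy].
Qed.

Lemma is_derive_clamp (f f1 : R -> R) y : 0 < y < 1 -> derivative_on_unit_at f f1 y ->
  is_derive (fun s => f (clamp s)) y (f1 y).
Proof.
intros Hy H; apply is_derive_Reals; intros e He.
destruct (H e He) as [d [Hd Hc]].
assert (Hd' : 0 < Rmin d (Rmin y (1 - y))) by (repeat apply Rmin_glb_lt; lra).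
exists (mkposreal _ Hd'); intros h Hh0 Hh; simpl in Hh.
assert (B1 := Rlt_le_trans _ _ _ Hh (Rmin_l _ _)).
assert (B2 := Rlt_le_trans _ _ _ Hh (Rmin_r _ _)).
assert (B3 := Rlt_le_trans _ _ _ B2 (Rmin_l _ _)).
assert (B4 := Rlt_le_trans _ _ _ B2 (Rmin_r _ _)).
apply Rabs_def2 in B3; apply Rabs_def2 in B4.
assert (Uh : unit_interval (y + h)) by (unfold unit_interval; lra).
rewrite (clamp_id (y + h)), (clamp_id y) by (assumption || unfold unit_interval; lra).
specialize (Hc (y + h)); simpl in Hc; unfold Rdist in Hc.
replace (y + h - y) with h in Hc by ring.
apply Hc; split; [split; [assumption|lra]|assumption].
Qed.

Lemma unit_mean_value (f f1 : R -> R) x t : continuous_on unit_interval f ->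
  unit_interval x -> unit_interval t ->
  (forall y, Rmin x t < y < Rmax x t -> derivative_on_unit_at f f1 y) ->
  exists c, Rmin x t <= c <= Rmax x t /\ f t - f x = f1 c * (t - x).
Proof.
intros Hf Hx Ht H.
destruct (MVT_gen (fun s => f (clamp s)) x t f1) as [c [Hc E]].
- intros y Hy; apply is_derive_clamp; [|apply H, Hy].
  unfold unit_interval in *; revert Hy; unfold Rmin, Rmax; destruct Rle_dec; lra.
- intros y _; apply continuity_pt_filterlim, continuous_clamp, Hf.
- exists c; rewrite !clamp_id in E by assumption; split; assumption.
Qed.

(** The mean value theorem applied to the remainder, whose derivative is
    f1 y - f1 x - d2 (y-x).  The hypothesis is on this difference because it
    follows from differentiability of f1 at x alone as well as from a bound on
    the oscillation of the derivative of f1. *)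
Lemma taylor2_estimate (f f1 : R -> R) d2 e x t :
  0 <= e -> continuous_on unit_interval f ->
  unit_interval x -> unit_interval t ->
  (forall y, Rmin x t <= y <= Rmax x t ->
     derivative_on_unit_at f f1 y /\
     Rabs (f1 y - f1 x - d2 * (y - x)) <= e * Rabs (y - x)) ->
  Rabs (f t - f x - f1 x * (t - x) - d2 / 2 * (t - x) ^ 2) <= e * (t - x) ^ 2.
Proof.
intros He Hf Hx Ht H.
destruct (MVT_gen (fun s => f (clamp s) - f1 x * s - d2 / 2 * (s - x) ^ 2) x t
   (fun y => f1 y - f1 x - d2 * (y - x))) as [c [Hc E]].
- intros y Hy.
  apply (is_derive_minus (fun s => f (clamp s) - f1 x * s)
          (fun s => d2 / 2 * (s - x) ^ 2)).
    apply (is_derive_minus (fun s => f (clamp s)) (fun s => f1 x * s)).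
      apply is_derive_clamp; [|apply H; lra].
      unfold unit_interval in *; revert Hy; unfold Rmin, Rmax;
        destruct Rle_dec; lra.
    auto_derive; [exact I|ring].
  auto_derive; [exact I|field].
- intros y _; apply continuity_pt_filterlim.
  apply (continuous_minus (fun s => f (clamp s) - f1 x * s)
          (fun s => d2 / 2 * (s - x) ^ 2)).
    apply (continuous_minus (fun s => f (clamp s)) (fun s => f1 x * s)).
      apply continuous_clamp, Hf.
    apply (ex_derive_continuous (V := R_NormedModule)); auto_derive; exact I.
  apply (ex_derive_continuous (V := R_NormedModule)); auto_derive; exact I.
- rewrite !clamp_id in E by assumption.
  replace (f t - f x - f1 x * (t - x) - d2 / 2 * (t - x) ^ 2)
    with ((f1 c - f1 x - d2 * (c - x)) * (t - x)) by (rewrite <- E; ring).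
  destruct (H c Hc) as [_ Hb].
  assert (Hct : Rabs (c - x) <= Rabs (t - x)).
    revert Hc; unfold Rmin, Rmax, Rabs; destruct Rle_dec;
      repeat destruct Rcase_abs; lra.
  rewrite Rabs_mult, <- (pow2_abs (t - x)).
  replace (e * Rabs (t - x) ^ 2) with (e * Rabs (t - x) * Rabs (t - x)) by ring.
  apply Rmult_le_compat_r; [apply Rabs_pos|].
  eapply Rle_trans; [exact Hb|apply Rmult_le_compat_l; assumption].
Qed.

(** Where |u| >= d, a bound B is at most B (u/d)^4. *)
Lemma local_to_global_remainder (r e d B u : R) : 0 <= e -> 0 < d ->
  (Rabs u < d -> Rabs r <= e * u ^ 2) -> Rabs r <= B ->
  Rabs r <= e * u ^ 2 + B / d ^ 4 * u ^ 4.
Proof.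
intros He Hd Hl HB.
assert (HB0 : 0 <= B) by (pose proof (Rabs_pos r); lra).
assert (Hd4 : 0 < d ^ 4) by (apply pow_lt; lra).
assert (Hu2 : 0 <= e * u ^ 2) by (apply Rmult_le_pos; [|apply pow2_ge_0]; lra).
assert (Hu4 : 0 <= u ^ 4) by (replace (u ^ 4) with ((u ^ 2) ^ 2) by ring;
  apply pow2_ge_0).
destruct (Rlt_le_dec (Rabs u) d) as [Hu|Hu].
- specialize (Hl Hu).
  assert (0 <= B / d ^ 4 * u ^ 4); [|lra].
  apply Rmult_le_pos; [|lra].
  apply Rmult_le_pos; [lra|left; apply Rinv_0_lt_compat; lra].
- assert (Hdu : d ^ 4 <= u ^ 4).
    replace (u ^ 4) with (Rabs u ^ 4).
      apply pow_incr; lra.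
    rewrite RPow_abs, Rabs_pos_eq by exact Hu4; reflexivity.
  assert (B <= B / d ^ 4 * u ^ 4); [|lra].
  apply Rle_trans with (B / d ^ 4 * d ^ 4); [right; field; lra|].
  apply Rmult_le_compat_l; [|exact Hdu].
  apply Rmult_le_pos; [lra|left; apply Rinv_0_lt_compat; lra].
Qed.

(** The differentiability of f1 at x makes f1 y - f1 x - d2 (y-x) small with
    respect to y - x, which is the hypothesis of [taylor2_estimate] near x; away
    from x, the boundedness of f is enough. *)
Lemma pointwise_remainder (f f1 : R -> R) x d2 : continuous_on unit_interval f ->
  unit_interval x -> second_derivative_at f f1 x d2 ->
  forall e, 0 < e -> exists K, 0 <= K /\ forall t, unit_interval t ->
  Rabs (f t - f x - f1 x * (t - x) - d2 / 2 * (t - x) ^ 2)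
  <= e * (t - x) ^ 2 + K * (t - x) ^ 4.
Proof.
intros Hf Hx [[r Hr] H2] e He.
destruct (H2 e He) as [d [Hd Hc]].
destruct (continuous_on_unit_bounded f Hf) as [B [HB0 HB]].
assert (Hd' : 0 < Rmin d r) by (apply Rmin_glb_lt; [lra|apply cond_pos]).
exists ((2 * B + Rabs (f1 x) + Rabs d2) / Rmin d r ^ 4); split.
  apply Rmult_le_pos; [pose proof (Rabs_pos (f1 x)); pose proof (Rabs_pos d2); lra|].
  left; apply Rinv_0_lt_compat, pow_lt, Hd'.
intros t Ht; apply local_to_global_remainder; [lra|exact Hd'| |].
- intros Htx.
  apply taylor2_estimate; try assumption; [lra|].
  intros y Hy.
  assert (Uy : unit_interval y).
    unfold unit_interval in *; revert Hy; unfold Rmin, Rmax; destruct Rle_dec; lra.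
  assert (Hyx : Rabs (y - x) < Rmin d r).
    eapply Rle_lt_trans; [|exact Htx].
    revert Hy; unfold Rmin, Rmax, Rabs; destruct Rle_dec;
      repeat destruct Rcase_abs; lra.
  split.
    apply Hr; [|exact Uy].
    exact (Rlt_le_trans _ _ _ Hyx (Rmin_r _ _)).
  destruct (Req_dec x y) as [<-|Hxy].
    rewrite !Rminus_diag, Rmult_0_r, Rminus_diag, Rabs_R0; lra.
  specialize (Hc y); simpl in Hc; unfold Rdist in Hc.
  replace (f1 y - f1 x - d2 * (y - x))
    with (((f1 y - f1 x) / (y - x) - d2) * (y - x)) by (field; lra).
  rewrite Rabs_mult; apply Rmult_le_compat_r; [apply Rabs_pos|].
  left; apply Hc; split; [split; assumption|].
  exact (Rlt_le_trans _ _ _ Hyx (Rmin_l _ _)).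
- assert (Hu : Rabs (t - x) <= 1).
    unfold unit_interval in *; apply Rabs_le; lra.
  assert (Hu2 : Rabs ((t - x) ^ 2) <= 1).
    rewrite Rabs_pos_eq by apply pow2_ge_0; rewrite <- pow2_abs.
    pose proof (Rabs_pos (t - x)); nra.
  assert (H1 := HB t Ht); assert (H3 := HB x Hx).
  assert (P1 : Rabs (f1 x * (t - x)) <= Rabs (f1 x)).
    rewrite Rabs_mult; pose proof (Rabs_pos (f1 x)); nra.
  assert (P2 : Rabs (d2 / 2 * (t - x) ^ 2) <= Rabs d2).
    rewrite Rabs_mult; unfold Rdiv; rewrite Rabs_mult, (Rabs_pos_eq (/ 2)) by lra.
    pose proof (Rabs_pos d2); nra.
  revert H1 H3 P1 P2; generalize (f1 x * (t - x)) (d2 / 2 * (t - x) ^ 2).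
  intros u v; unfold Rabs at 1 2 3 5 7; repeat destruct Rcase_abs; lra.
Qed.

(** The constant K depends only on a bound of f2 and on its modulus of
    continuity, not on x. *)
Lemma uniform_remainder (f f1 f2 : R -> R) :
  (forall x, unit_interval x -> derivative_on_unit_at f f1 x) ->
  (forall x, unit_interval x -> derivative_on_unit_at f1 f2 x) ->
  continuous_on unit_interval f2 ->
  forall e, 0 < e -> exists K, 0 <= K /\ forall x t,
  unit_interval x -> unit_interval t ->
  Rabs (f t - f x - f1 x * (t - x) - f2 x / 2 * (t - x) ^ 2)
  <= e * (t - x) ^ 2 + K * (t - x) ^ 4.
Proof.
intros D1 D2 Hf2 e He.
assert (Hf := D_in_continuous_on f f1 D1).
assert (Hf1 := D_in_continuous_on f1 f2 D2).
destruct (continuous_on_unit_bounded f2 Hf2) as [B [HB0 HB]].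
assert (Hu : uniform_continuity (fun t => f2 (clamp t)) unit_interval).
  apply Heine; [apply compact_P3|].
  intros t _; apply continuity_pt_filterlim, continuous_clamp, Hf2.
destruct (Hu (mkposreal e He)) as [d Hd]; simpl in Hd.
assert (Hd4 : 0 < d ^ 4) by (apply pow_lt, cond_pos).
(* The oscillation of f2 is used twice: near x it is at most e, and everywhere
   it is at most 2B. *)
assert (Hosc : forall x t w, unit_interval x -> unit_interval t -> 0 <= w ->
    (forall c, Rmin x t <= c <= Rmax x t -> Rabs (f2 c - f2 x) <= w) ->
    Rabs (f t - f x - f1 x * (t - x) - f2 x / 2 * (t - x) ^ 2)
    <= w * (t - x) ^ 2).
  intros x t w Hx Ht Hw Hosc; apply taylor2_estimate; try assumption.
  intros y Hy.
  assert (Uy : unit_interval y).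
    unfold unit_interval in *; revert Hy; unfold Rmin, Rmax; destruct Rle_dec; lra.
  split; [apply D1, Uy|].
  destruct (unit_mean_value f1 f2 x y Hf1 Hx Uy) as [c [Hc E]].
    intros z Hz; apply D2.
    unfold unit_interval in *; revert Hz; unfold Rmin, Rmax; destruct Rle_dec; lra.
  rewrite E.
  replace (f2 c * (y - x) - f2 x * (y - x)) with ((f2 c - f2 x) * (y - x)) by ring.
  rewrite Rabs_mult; apply Rmult_le_compat_r; [apply Rabs_pos|].
  apply Hosc; revert Hc Hy; unfold Rmin, Rmax; repeat destruct Rle_dec; lra.
exists (2 * B / d ^ 4); split.
  apply Rmult_le_pos; [lra|left; apply Rinv_0_lt_compat, Hd4].
intros x t Hx Ht.
assert (Uc : forall c, Rmin x t <= c <= Rmax x t -> unit_interval c).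
  intros c; unfold unit_interval in *; unfold Rmin, Rmax; destruct Rle_dec; lra.
apply local_to_global_remainder; [lra|apply cond_pos| |].
- intros Htx; apply Hosc; try assumption; [lra|].
  intros c Hc.
  rewrite <- (clamp_id c), <- (clamp_id x) by auto.
  left; apply Hd; try assumption; [auto|].
  eapply Rle_lt_trans; [|exact Htx].
  revert Hc; unfold Rmin, Rmax, Rabs; destruct Rle_dec;
    repeat destruct Rcase_abs; lra.
- apply Rle_trans with (2 * B * (t - x) ^ 2).
    apply Hosc; try assumption; [lra|].
    intros c Hc; assert (H1 := HB c (Uc c Hc)); assert (H2 := HB x Hx).
    revert H1 H2; unfold Rabs; repeat destruct Rcase_abs; lra.
  unfold unit_interval in *; assert ((t - x) ^ 2 <= 1) by nra; nra.
Qed.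

(** * Asymptotics of the operator *)

Lemma scaled_quotient_bound N c B D : 0 < N -> N ^ 2 <= D ->
  Rabs c <= B * N -> Rabs (c / D) <= B / N.
Proof.
intros HN HD Hc.
assert (HN2 : 0 < N ^ 2) by (apply pow_lt, HN).
unfold Rdiv; rewrite Rabs_mult, (Rabs_pos_eq (/ D))
  by (left; apply Rinv_0_lt_compat; lra).
apply Rle_trans with (B * N * / N ^ 2); [|right; field; lra].
apply Rmult_le_compat; [apply Rabs_pos| |exact Hc|].
  left; apply Rinv_0_lt_compat; lra.
apply Rinv_le_contravar; lra.
Qed.

(** A quantitative form with explicit dependence on the data: all the terms on
    the right but the first are O(1/n), uniformly in x as long as p, q, K stay
    bounded, and e is arbitrarily small in the applications. *)
Lemma voronovskaja_estimate a0 a1 m (f : R -> R) x p q e K A :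
  continuous_on unit_interval f -> unit_interval x ->
  Rabs (a0 (S m)) <= A -> Rabs (a1 (S m)) <= A ->
  2 * a0 (S m) + a1 (S m) = 1 -> 0 <= e -> 0 <= K ->
  (forall t, unit_interval t ->
     Rabs (f t - f x - p * (t - x) - q * (t - x) ^ 2)
     <= e * (t - x) ^ 2 + K * (t - x) ^ 4) ->
  Rabs (INR (S m) * (DM1 a0 a1 (S m) f x - f x)
        - ((1 - 2 * x) * (2 * a1 (S m) + 3 * a0 (S m)) * p
           + 2 * (x * (1 - x)) * q))
  <= 4 * A * e
     + (10 * A * Rabs p + (6 + 24 * A) * Rabs q + 400 * A * K) / INR (S m).
Proof.
intros Hf Hx Ha0 Ha1 Hs He HK Hrem.
rewrite DM1_adjacent_mean, S_INR.
set (a := acoef a0 a1 x (S m)); set (b := acoef a0 a1 (1 - x) (S m)).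
assert (Ea : a = a1 (S m) * x + a0 (S m)) by reflexivity.
assert (Eb : b = a1 (S m) * (1 - x) + a0 (S m)) by reflexivity.
clearbody a b; revert Ea Eb Ha0 Ha1 Hs; generalize (a0 (S m)) (a1 (S m)).
clear a0 a1; intros c0 c1 Ea Eb Ha0 Ha1 Hs.
set (M := INR m); assert (HM : 0 <= M) by apply pos_INR.
pose (r := fun t => f (clamp t) - f x - p * (t - x) - q * (t - x) ^ 2).
assert (Hq : forall u v w t,
    continuous (fun t => u + v * (t - x) + w * (t - x) ^ 2) t).
  intros u v w t; apply (ex_derive_continuous (V := R_NormedModule)).
  auto_derive; exact I.
assert (Hr : forall t, continuous r t).
  intros t; apply continuous_ext with
    (fun t => f (clamp t) - (f x + p * (t - x) + q * (t - x) ^ 2)).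
    intros s; apply Rminus_diag_uniq; unfold r; ring.
  apply (continuous_minus (V := R_NormedModule)); [|apply Hq].
  apply continuous_clamp, Hf.
rewrite (adjacent_mean_ext a b m f
  (fun t => (f x + p * (t - x) + q * (t - x) ^ 2) + r t)).
2: intros t Ht; unfold r; rewrite clamp_id by exact Ht; ring.
rewrite adjacent_mean_plus, adjacent_mean_quadratic by auto.
cbv zeta; fold M.
destruct Hx as [Hx0 Hx1].
assert (HA : 0 <= A) by (pose proof (Rabs_pos c0); lra).
assert (Ba : Rabs a <= 2 * A).
  rewrite Ea; eapply Rle_trans; [apply Rabs_triang|].
  rewrite Rabs_mult, (Rabs_pos_eq x) by lra; pose proof (Rabs_pos c1); nra.
assert (Bb : Rabs b <= 2 * A).
  rewrite Eb; eapply Rle_trans; [apply Rabs_triang|].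
  rewrite Rabs_mult, (Rabs_pos_eq (1 - x)) by lra; pose proof (Rabs_pos c1); nra.
assert (BR : Rabs ((M + 1) * adjacent_mean a b m r x)
             <= 2 * A * (2 * e + 200 * K / (M + 1))).
  rewrite Rabs_mult, (Rabs_pos_eq (M + 1)) by lra.
  apply Rle_trans with (2 * A * ((M + 1) *
    adjacent_mean 1 1 m (fun t => e * (t - x) ^ 2 + K * (t - x) ^ 4) x)).
    rewrite <- Rmult_assoc, (Rmult_comm (2 * A)), Rmult_assoc.
    apply Rmult_le_compat_l; [lra|].
    apply adjacent_mean_abs_le; try assumption; [split; lra| |].
      intros t; apply (ex_derive_continuous (V := R_NormedModule)).
      auto_derive; exact I.
    intros t Ht; unfold r; rewrite clamp_id by exact Ht; apply Hrem, Ht.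
  apply Rmult_le_compat_l; [lra|].
  apply adjacent_mean_even_le; [split; lra|exact He|exact HK].
revert BR; generalize (adjacent_mean a b m r x); intros S BR.
set (X := x * (1 - x)).
assert (HX : 0 <= X <= 1 / 4)
  by (unfold X; pose proof (pow2_ge_0 (x - 1 / 2)); split; nra).
assert (Hab : a + b = 1) by (rewrite Ea, Eb; lra).
set (g := a * (2 - 8 * x + 12 * x ^ 2) + b * (6 - 16 * x + 12 * x ^ 2)).
assert (Bg : Rabs g <= 24 * A).
  unfold g; eapply Rle_trans; [apply Rabs_triang|]; rewrite !Rabs_mult.
  rewrite (Rabs_pos_eq (2 - 8 * x + 12 * x ^ 2))
    by (pose proof (pow2_ge_0 (3 * x - 1)); lra).
  rewrite (Rabs_pos_eq (6 - 16 * x + 12 * x ^ 2))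
    by (pose proof (pow2_ge_0 (3 * x - 2)); lra).
  assert (2 - 8 * x + 12 * x ^ 2 <= 6) by nra.
  assert (6 - 16 * x + 12 * x ^ 2 <= 6) by nra.
  pose proof (Rabs_pos a); pose proof (Rabs_pos b).
  assert (Rabs a * (2 - 8 * x + 12 * x ^ 2) <= Rabs a * 6)
    by (apply Rmult_le_compat_l; assumption).
  assert (Rabs b * (6 - 16 * x + 12 * x ^ 2) <= Rabs b * 6)
    by (apply Rmult_le_compat_l; assumption).
  lra.
set (u := (1 - 2 * x) * (2 * c1 + 3 * c0)).
assert (Bu : Rabs u <= 5 * A).
  unfold u; rewrite Rabs_mult.
  assert (Rabs (1 - 2 * x) <= 1) by (apply Rabs_le; lra).
  assert (Rabs (2 * c1 + 3 * c0) <= 5 * A).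
    revert Ha0 Ha1; unfold Rabs; repeat destruct Rcase_abs; lra.
  rewrite <- (Rmult_1_l (5 * A)).
  apply Rmult_le_compat; (apply Rabs_pos || assumption).
(* p' and q' are the deviations of n times the first two central moments from
   u and 2X. *)
set (p' := -2 * u * (M + 1) / ((M + 1) * (M + 3))).
set (q' := (- (12 * M + 24) * X + (M + 1) * g) / ((M + 3) * (M + 4))).
assert (Bp : Rabs p' <= 10 * A / (M + 1)).
  apply scaled_quotient_bound; [lra|nra|].
  rewrite Rabs_mult, (Rabs_pos_eq (M + 1)) by lra.
  apply Rmult_le_compat_r; [lra|].
  rewrite Rabs_mult, (Rabs_left (-2)) by lra; lra.
assert (Bq : Rabs q' <= (6 + 24 * A) / (M + 1)).
  apply scaled_quotient_bound; [lra|nra|].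
  eapply Rle_trans; [apply Rabs_triang|].
  rewrite !Rabs_mult, (Rabs_pos_eq X), (Rabs_pos_eq (M + 1)), Rabs_Ropp,
    (Rabs_pos_eq (12 * M + 24)) by lra.
  assert ((12 * M + 24) * X <= (12 * M + 24) * (1 / 4))
    by (apply Rmult_le_compat_l; lra).
  assert ((M + 1) * Rabs g <= (M + 1) * (24 * A))
    by (apply Rmult_le_compat_l; lra).
  nra.
replace ((M + 1) * _ - _) with (p * p' + q * q' + (M + 1) * S).
2: { unfold p', q', u, g; rewrite Hab, Ea, Eb.
     replace c1 with (1 - 2 * c0) by lra; unfold X; field; lra. }
eapply Rle_trans; [apply Rabs_triang|].
eapply Rle_trans; [apply Rplus_le_compat_r, Rabs_triang|].
rewrite (Rabs_mult p), (Rabs_mult q).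
assert (Rabs p * Rabs p' <= Rabs p * (10 * A / (M + 1)))
  by (apply Rmult_le_compat_l; [apply Rabs_pos|exact Bp]).
assert (Rabs q * Rabs q' <= Rabs q * ((6 + 24 * A) / (M + 1)))
  by (apply Rmult_le_compat_l; [apply Rabs_pos|exact Bq]).
replace (4 * A * e + _) with (Rabs p * (10 * A / (M + 1))
  + Rabs q * ((6 + 24 * A) / (M + 1)) + 2 * A * (2 * e + 200 * K / (M + 1)))
  by (field; lra).
lra.
Qed.

(** The order of the quantifiers matters: e is chosen from eps, then the constant
    K of the Taylor remainder may depend on e, and only then comes N.  As N
    depends on p and d2 through bounds only and on x not at all, this yields both
    the pointwise and the uniform limit. *)
Lemma voronovskaja_of_remainder a0 a1 l0 l1 (f : R -> R) :
  (exists M, forall n, Rabs (a0 n) <= M) ->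
  (exists M, forall n, Rabs (a1 n) <= M) ->
  is_lim_seq a0 (Finite l0) -> is_lim_seq a1 (Finite l1) ->
  (forall n, (1 <= n)%nat -> 2 * a0 n + a1 n = 1) ->
  continuous_on unit_interval f ->
  forall eps, 0 < eps -> exists e, 0 < e /\
  forall K P Q, 0 <= K -> exists N, forall n, (N <= n)%nat ->
  forall x p d2, unit_interval x -> Rabs p <= P -> Rabs d2 <= Q ->
  (forall t, unit_interval t ->
     Rabs (f t - f x - p * (t - x) - d2 / 2 * (t - x) ^ 2)
     <= e * (t - x) ^ 2 + K * (t - x) ^ 4) ->
  Rabs (INR n * (DM1 a0 a1 n f x - f x)
        - ((1 - 2 * x) * (2 * l1 + 3 * l0) * p
           + x * (1 - x) * (2 * l0 + l1) * d2)) < eps.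
Proof.
intros [A0 HA0] [A1 HA1] L0 L1 Hs Hf eps Heps.
(* In the limit the coefficient 2 l0 + l1 of the second derivative is 1. *)
assert (Hl : 2 * l0 + l1 = 1).
  assert (H : is_lim_seq (fun n => 2 * a0 n + a1 n) (Finite (2 * l0 + l1))).
    apply is_lim_seq_plus'; [|exact L1].
    apply (is_lim_seq_scal_l a0 2 l0), L0.
  assert (H1 : is_lim_seq (fun n => 2 * a0 n + a1 n) (Finite 1)).
    apply is_lim_seq_ext_loc with (fun _ => 1); [|apply is_lim_seq_const].
    exists 1%nat; intros n Hn; symmetry; apply Hs, Hn.
  apply is_lim_seq_unique in H; apply is_lim_seq_unique in H1.
  rewrite H in H1; injection H1; auto.
assert (Hc : is_lim_seq (fun n => 2 * a1 n + 3 * a0 n)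
               (Finite (2 * l1 + 3 * l0))).
  apply is_lim_seq_plus'.
    apply (is_lim_seq_scal_l a1 2 l1), L1.
  apply (is_lim_seq_scal_l a0 3 l0), L0.
set (A := A0 + A1).
assert (HA : 0 <= A0 /\ 0 <= A1).
  split; [eapply Rle_trans; [apply Rabs_pos|apply (HA0 0%nat)]
         |eapply Rle_trans; [apply Rabs_pos|apply (HA1 0%nat)]].
exists (eps / (16 * (A + 1))); split.
  apply Rdiv_lt_0_compat; unfold A; lra.
intros K P Q HK.
set (P' := Rmax 0 P); set (Q' := Rmax 0 Q).
assert (HP : 0 <= P') by apply Rmax_l.
assert (HQ : 0 <= Q') by apply Rmax_l.
set (C := 10 * A * P' + (6 + 24 * A) * Q' + 400 * A * K).
assert (HC : 0 <= C).
  assert (0 <= A) by (unfold A; lra).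
  unfold C; repeat apply Rplus_le_le_0_compat; repeat apply Rmult_le_pos; lra.
assert (Hd : 0 < eps / (4 * (P' + 1))) by (apply Rdiv_lt_0_compat; lra).
apply is_lim_seq_spec in Hc.
destruct (Hc (mkposreal _ Hd)) as [N1 HN1]; simpl in HN1.
destruct (nfloor_ex (4 * C / eps)) as [N2 [_ HN2]].
  apply Rmult_le_pos; [lra|left; apply Rinv_0_lt_compat, Heps].
exists (max N1 (S N2)); intros n Hn x p d2 Hx Hp Hd2 Hrem.
assert (Hn1 : (N1 <= n)%nat) by lia; specialize (HN1 n Hn1).
destruct n as [|m]; [lia|].
assert (HSm : 4 * C / eps < INR (S m)).
  eapply Rlt_le_trans; [exact HN2|]; rewrite <- S_INR; apply le_INR; lia.
assert (Hpos : 0 < INR (S m)) by apply lt_0_INR, Nat.lt_0_succ.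
assert (HP' : Rabs p <= P') by (eapply Rle_trans; [exact Hp|apply Rmax_r]).
assert (HQ' : Rabs d2 <= Q') by (eapply Rle_trans; [exact Hd2|apply Rmax_r]).
assert (HA0' : Rabs (a0 (S m)) <= A)
  by (unfold A; specialize (HA0 (S m)); lra).
assert (HA1' : Rabs (a1 (S m)) <= A)
  by (unfold A; specialize (HA1 (S m)); lra).
assert (He : 0 < eps / (16 * (A + 1))) by (apply Rdiv_lt_0_compat; unfold A; lra).
assert (H := voronovskaja_estimate a0 a1 m f x p (d2 / 2) _ K A Hf Hx HA0' HA1'
  (Hs (S m) (le_n_S _ _ (Nat.le_0_l m))) (Rlt_le _ _ He) HK Hrem).
assert (HA' : 0 <= A) by (unfold A; lra).
assert (T1 : 4 * A * (eps / (16 * (A + 1))) <= eps / 4).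
  replace (4 * A * (eps / (16 * (A + 1)))) with (eps / 4 * (A / (A + 1)))
    by (field; lra).
  assert (A / (A + 1) <= 1); [|nra].
  apply Rmult_le_reg_r with (A + 1); [lra|]; field_simplify; lra.
assert (T2 : (10 * A * Rabs p + (6 + 24 * A) * Rabs (d2 / 2) + 400 * A * K)
             / INR (S m) < eps / 4).
  apply Rle_lt_trans with (C / INR (S m)).
    apply Rmult_le_compat_r; [left; apply Rinv_0_lt_compat, Hpos|].
    unfold C; apply Rplus_le_compat_r, Rplus_le_compat.
      apply Rmult_le_compat_l; lra.
    apply Rmult_le_compat_l; [lra|].
    unfold Rdiv; rewrite Rabs_mult, (Rabs_pos_eq (/ 2)) by lra.
    pose proof (Rabs_pos d2); lra.
  apply Rmult_lt_reg_r with (INR (S m) * (4 / eps)).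
    apply Rmult_lt_0_compat; [exact Hpos|apply Rdiv_lt_0_compat; lra].
  replace (C / INR (S m) * (INR (S m) * (4 / eps))) with (4 * C / eps)
    by (field; lra).
  replace (eps / 4 * (INR (S m) * (4 / eps))) with (INR (S m)) by (field; lra).
  exact HSm.
assert (T3 : Rabs ((1 - 2 * x) * p *
    (2 * a1 (S m) + 3 * a0 (S m) - (2 * l1 + 3 * l0))) <= eps / 4).
  rewrite !Rabs_mult.
  assert (Rabs (1 - 2 * x) <= 1) by (destruct Hx; apply Rabs_le; lra).
  apply Rle_trans with (1 * P' * (eps / (4 * (P' + 1)))).
    apply Rmult_le_compat; try apply Rmult_le_compat; try apply Rmult_le_pos;
      try apply Rabs_pos; lra.
  replace (1 * P' * (eps / (4 * (P' + 1)))) with (eps / 4 * (P' / (P' + 1)))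
    by (field; lra).
  assert (P' / (P' + 1) <= 1); [|nra].
  apply Rmult_le_reg_r with (P' + 1); [lra|]; field_simplify; lra.
rewrite Hl.
replace (INR (S m) * (DM1 a0 a1 (S m) f x - f x) - _) with
  ((INR (S m) * (DM1 a0 a1 (S m) f x - f x)
     - ((1 - 2 * x) * (2 * a1 (S m) + 3 * a0 (S m)) * p
        + 2 * (x * (1 - x)) * (d2 / 2)))
   + (1 - 2 * x) * p * (2 * a1 (S m) + 3 * a0 (S m) - (2 * l1 + 3 * l0)))
  by field.
eapply Rle_lt_trans; [apply Rabs_triang|]; lra.
Qed.

Theorem theorem2p5 (a0 a1 : nat -> R) (l0 l1 : R) (f : R -> R)
  (a0_bounded : exists M : R, forall n : nat, Rabs (a0 n) <= M)
  (a1_bounded : exists M : R, forall n : nat, Rabs (a1 n) <= M)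
  (a0_lim : is_lim_seq a0 l0)
  (a1_lim : is_lim_seq a1 l1)
  (a_sum : forall n : nat, (1 <= n)%nat -> 2 * a0 n + a1 n = 1)
  (a_neg : forall n : nat, (1 <= n)%nat -> a0 n < 0 \/ a1 n + a0 n < 0)
  (f_cont : continuous_on unit_interval f) :
  (forall (x : R) (f1 : R -> R) (d2 : R),
     unit_interval x ->
     second_derivative_at f f1 x d2 ->
     is_lim_seq (fun n => INR n * (DM1 a0 a1 n f x - f x))
       ((1 - 2 * x) * (2 * l1 + 3 * l0) * f1 x
        + x * (1 - x) * (2 * l0 + l1) * d2))
  /\
  (forall f1 f2 : R -> R,
     (forall x : R, unit_interval x -> derivative_on_unit_at f f1 x) ->
     (forall x : R, unit_interval x -> derivative_on_unit_at f1 f2 x) ->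
     continuous_on unit_interval f2 ->
     forall eps : R, 0 < eps ->
     exists N : nat, forall n : nat, (N <= n)%nat ->
     forall x : R, unit_interval x ->
       Rabs (INR n * (DM1 a0 a1 n f x - f x)
             - ((1 - 2 * x) * (2 * l1 + 3 * l0) * f1 x
                + x * (1 - x) * (2 * l0 + l1) * f2 x)) < eps).
Proof.
assert (V := voronovskaja_of_remainder a0 a1 l0 l1 f a0_bounded a1_bounded
  a0_lim a1_lim a_sum f_cont).
split.
- intros x f1 d2 Hx Hf2; apply is_lim_seq_spec; intros eps.
  destruct (V eps (cond_pos eps)) as [e [He H]].
  destruct (pointwise_remainder f f1 x d2 f_cont Hx Hf2 e He) as [K [HK Hrem]].
  destruct (H K (Rabs (f1 x)) (Rabs d2) HK) as [N HN].
  exists N; intros n Hn; apply HN; auto using Rle_refl.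
- intros f1 f2 D1 D2 Hf2 eps Heps.
  destruct (V eps Heps) as [e [He H]].
  destruct (uniform_remainder f f1 f2 D1 D2 Hf2 e He) as [K [HK Hrem]].
  destruct (continuous_on_unit_bounded f1 (D_in_continuous_on f1 f2 D2))
    as [P [_ HP]].
  destruct (continuous_on_unit_bounded f2 Hf2) as [Q [_ HQ]].
  destruct (H K P Q HK) as [N HN].
  exists N; intros n Hn x Hx; apply HN; auto.
Qed.
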